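(* Let $c>0$ and let $(p,u,v)$, with $p,u,v:\mathbb{R}^2\times[0,\infty)\to\mathbb{R}$ of class $C^3$, be a solution of the two-dimensional acoustic equations $$\partial_t p + c(\partial_x u+\partial_y v)=0,\qquad \partial_t u + c\,\partial_x p=0,\qquad \partial_t v + c\,\partial_y p = 0 .$$ Fix $(x,y)\in\mathbb{R}^2$, $t\ge 0$ and $\delta\in[0,1]$. For $\Delta t>0$ put $P=(x,y,t+\Delta t)$, and for $R\ge 0$ put $\mathbf{Q}_R(\theta)=(x+R\cos\theta,\;y+R\sin\theta,\;t)$, $\theta\in[0,2\pi]$, and $\mathbf{Q}(\theta)=\mathbf{Q}_{c\Delta t}(\theta)$. Then, as $\Delta t\to0$, $$p(P)=\frac1\pi\int_0^{2\pi}\Big(p(\mathbf{Q}(\theta))-u(\mathbf{Q}(\theta))\cos\theta-v(\mathbf{Q}(\theta))\sin\theta\Big)d\theta-\frac13\left(\frac{4}{2\pi}\int_0^{2\pi}p\big(\mathbf{Q}_{\frac{\delta}{2}c\Delta t}(\theta)\big)d\theta-\frac1{2\pi}\int_0^{2\pi}p\big(\mathbf{Q}_{\delta c\Delta t}(\theta)\big)d\theta\right)+\mathcal{O}(\Delta t^3).$$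
   Context: Here $p$ is the pressure, $(u,v)$ the velocity and $c$ the constant speed of sound. The formula (without the error term) is the pressure update of the approximate evolution operators called $\mathrm{EG2}_\delta$ and $\mathrm{EG2}_{\delta,\nu}$. The notation $\mathcal{O}(\Delta t^3)$ means a quantity bounded by $K\Delta t^3$ for all sufficiently small $\Delta t>0$, where $K$ may depend on the solution, on $c$, on $\delta$ and on the fixed point $(x,y,t)$. *)

(* Defs.v *)
From Stdlib Require Import Reals Lra.
From Coquelicot Require Import Coquelicot.
Open Scope R_scope.

(** Functions on [R^2 x [0, oo)] are represented by functions on
    [R * R * R] (space, space, time) whose values at negative times are
    irrelevant: everything below only looks at points of [spacetime]. *)
Definition spacetime (X : R * R * R) : Prop := 0 <= snd X.

Definition is_partial_x (f : R * R * R -> R) (X : R * R * R) (l : R) : Prop :=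
  let '(x, y, t) := X in is_derive (fun z : R => f (z, y, t)) x l.

Definition is_partial_y (f : R * R * R -> R) (X : R * R * R) (l : R) : Prop :=
  let '(x, y, t) := X in is_derive (fun z : R => f (x, z, t)) y l.

(** The time derivative is taken relative to [[0, oo)]: for [t > 0] this is
    [is_derive], and at [t = 0] it is the right derivative. *)
Definition is_partial_t (f : R * R * R -> R) (X : R * R * R) (l : R) : Prop :=
  let '(x, y, t) := X in
  filterdiff (fun s : R => f (x, y, s))
    (within (fun s : R => 0 <= s) (locally t)) (fun h : R => scal h l).

(** Class [C^k] on [R^2 x [0, oo)], up to the boundary [t = 0]: all iterated
    partial derivatives of order at most [k] exist and are jointly continuous
    on the closed half-space. *)
Fixpoint class_C (k : nat) (f : R * R * R -> R) : Prop :=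
  continuous_on spacetime f /\
  match k with
  | O => True
  | S k' =>
      exists fx fy ft : R * R * R -> R,
        (forall X, spacetime X ->
           is_partial_x f X (fx X) /\
           is_partial_y f X (fy X) /\
           is_partial_t f X (ft X)) /\
        class_C k' fx /\ class_C k' fy /\ class_C k' ft
  end.

Definition acoustic_solution (c : R) (p u v : R * R * R -> R) : Prop :=
  forall X, spacetime X ->
    exists pt px py ut ux vt vy : R,
      is_partial_t p X pt /\ is_partial_x p X px /\ is_partial_y p X py /\
      is_partial_t u X ut /\ is_partial_x u X ux /\
      is_partial_t v X vt /\ is_partial_y v X vy /\
      pt + c * (ux + vy) = 0 /\
      ut + c * px = 0 /\
      vt + c * py = 0.

Definition circle_pt (x y t r theta : R) : R * R * R :=
  (x + r * cos theta, y + r * sin theta, t).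

Definition EG2_pressure (c delta : R) (p u v : R * R * R -> R)
    (x y t dt : R) : R :=
  1 / PI * RInt (fun theta : R =>
      p (circle_pt x y t (c * dt) theta)
      - u (circle_pt x y t (c * dt) theta) * cos theta
      - v (circle_pt x y t (c * dt) theta) * sin theta) 0 (2 * PI)
  - 1 / 3 *
    (4 / (2 * PI) * RInt (fun theta : R =>
        p (circle_pt x y t (delta / 2 * c * dt) theta)) 0 (2 * PI)
     - 1 / (2 * PI) * RInt (fun theta : R =>
        p (circle_pt x y t (delta * c * dt) theta)) 0 (2 * PI)).

(* Main.v *)
Require Import Defs.
From Stdlib Require Import Reals Lra.
From Coquelicot Require Import Coquelicot.
Open Scope R_scope.

(** Both sides are expanded to second order at (x, y, t) and compared.

    In time, p(x, y, t + dt) = p + dt p_t + (dt^2/2) p_tt + O(dt^3), where the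
    equations give p_t = - c (u_x + v_y) and, exchanging derivatives in
    u_xt = u_tx = - c p_xx and v_yt = v_ty = - c p_yy,
    p_tt = c^2 (p_xx + p_yy).

    In space, with r = c dt, integration over the circle kills the monomials
    of odd degree in cos or in sin, so that up to O(r^3) the integral of p is
    2 pi p + (pi r^2/2) (p_xx + p_yy), that of u cos is pi r u_x and that of
    v sin is pi r v_y ([circle_integral], [circle_moment_cos],
    [circle_moment_sin]).  The first term of the operator therefore equals
    2 p - r (u_x + v_y) + (r^2/2) (p_xx + p_yy), which is the time expansion
    plus one extra copy of p.  The bracket multiplied by 1/3 has means with
    weights 4 and -1 on circles whose squared radii are in ratio 1 to 4: the
    second-order terms cancel and 3 p remains, whatever delta is.  This removes
    the extra copy.

    Everything rests on one mechanism.  If a partial derivative of f is affine in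
    the displacement up to order n, the mean value theorem makes the increment
    of f along that axis quadratic up to order n + 1 ([increment_x],
    [increment_y], [increment_t]).  Used twice, it turns continuity of the
    second derivatives of a C^2 function into a first-order expansion with
    quadratic error ([class_C2_expansion]).  Applied to the first derivatives
    of p, u and v, such expansions yield the circle and time expansions and also
    the exchange of derivatives up to the boundary t = 0 ([clairaut_xt],
    [clairaut_yt]), since two expressions of the same rectangular difference of
    f have to agree to third order. *)

(** * Orders of smallness in the displacement *)

Definition size (h k s : R) : R := Rabs h + Rabs k + Rabs s.

Lemma size_ge0 h k s : 0 <= size h k s.
Proof.
unfold size; pose proof (Rabs_pos h); pose proof (Rabs_pos k).
pose proof (Rabs_pos s); lra.
Qed.

Lemma size_drop_h h k s : size 0 k s <= size h k s.
Proof. unfold size; rewrite Rabs_R0; pose proof (Rabs_pos h); lra. Qed.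

Lemma size_drop_s h k s : size h k 0 <= size h k s.
Proof. unfold size; rewrite Rabs_R0; pose proof (Rabs_pos s); lra. Qed.

Lemma size_drop_hk h k s : size 0 0 s <= size h k s.
Proof.
unfold size; rewrite Rabs_R0; pose proof (Rabs_pos h); pose proof (Rabs_pos k); lra.
Qed.

Lemma size_swap_xy h k s : size k h s <= size h k s.
Proof. unfold size; lra. Qed.

(** The displacements (h, k, s) have s nonnegative, so that a base point with
    nonnegative time is only moved inside [spacetime]. *)
Definition small_O (n : nat) (g : R -> R -> R -> R) : Prop :=
  exists K e : R, 0 <= K /\ 0 < e /\
    forall h k s : R, 0 <= s -> size h k s < e ->
      Rabs (g h k s) <= K * size h k s ^ n.

Lemma small_O_ext n g1 g2 :
  (forall h k s, 0 <= s -> g1 h k s = g2 h k s) -> small_O n g1 -> small_O n g2.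
Proof.
intros E (K & e & HK & He & H); exists K, e; repeat split; trivial.
intros h k s Hs Hd; rewrite <- E by assumption; auto.
Qed.

Lemma small_O_lin n a b g1 g2 :
  small_O n g1 -> small_O n g2 ->
  small_O n (fun h k s => a * g1 h k s + b * g2 h k s).
Proof.
intros (K1 & e1 & HK1 & He1 & H1) (K2 & e2 & HK2 & He2 & H2).
exists (Rabs a * K1 + Rabs b * K2), (Rmin e1 e2); repeat split.
- pose proof (Rmult_le_pos _ _ (Rabs_pos a) HK1).
  pose proof (Rmult_le_pos _ _ (Rabs_pos b) HK2); lra.
- now apply Rmin_glb_lt.
- intros h k s Hs Hd.
  pose proof (Rmin_l e1 e2); pose proof (Rmin_r e1 e2).
  assert (D1 := H1 h k s Hs ltac:(lra)); assert (D2 := H2 h k s Hs ltac:(lra)).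
  eapply Rle_trans; [apply Rabs_triang|]; rewrite !Rabs_mult.
  pose proof (Rmult_le_compat_l _ _ _ (Rabs_pos a) D1).
  pose proof (Rmult_le_compat_l _ _ _ (Rabs_pos b) D2); lra.
Qed.

Lemma small_O_plus n g1 g2 :
  small_O n g1 -> small_O n g2 ->
  small_O n (fun h k s => g1 h k s + g2 h k s).
Proof.
intros H1 H2; apply (small_O_ext n (fun h k s => 1 * g1 h k s + 1 * g2 h k s)).
- intros; ring.
- now apply small_O_lin.
Qed.

(** Serves to drop coordinates of the displacement, or to exchange two of them. *)
Lemma small_O_subst n g h' k' s' :
  (forall h k s, 0 <= s -> 0 <= s' h k s) ->
  (forall h k s, size (h' h k s) (k' h k s) (s' h k s) <= size h k s) ->
  small_O n g -> small_O n (fun h k s => g (h' h k s) (k' h k s) (s' h k s)).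
Proof.
intros Hs' Hle (K & e & HK & He & H); exists K, e; repeat split; trivial.
intros h k s Hs Hd; specialize (Hle h k s).
eapply Rle_trans; [apply H; [now apply Hs' | lra]|].
apply Rmult_le_compat_l; trivial; apply pow_incr; split; trivial.
apply size_ge0.
Qed.

Lemma continuous_small_O_0 f x y t :
  0 <= t -> continuous_on spacetime f ->
  small_O 0 (fun h k s => f (x + h, y + k, t + s)).
Proof.
intros Ht Hf.
destruct (Hf (x, y, t) Ht (ball (f (x, y, t)) 1)
  (locally_ball _ (mkposreal 1 Rlt_0_1))) as [e He].
exists (Rabs (f (x, y, t)) + 1), e; repeat split.
- pose proof (Rabs_pos (f (x, y, t))); lra.
- apply cond_pos.
- intros h k s Hs Hd; unfold size in Hd.
  pose proof (Rabs_pos h); pose proof (Rabs_pos k); pose proof (Rabs_pos s).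
  assert (B : ball (f (x, y, t)) 1 (f (x + h, y + k, t + s))).
  { apply He; [|unfold spacetime; simpl; lra].
    assert (Hb : forall a d : R, Rabs d < e -> ball a e (a + d)).
    { intros a d Hde; change (Rabs (a + d - a) < e).
      replace (a + d - a) with d by (simpl; ring); assumption. }
    repeat split; apply Hb; lra. }
  change (Rabs (f (x + h, y + k, t + s) - f (x, y, t)) < 1) in B.
  pose proof (Rabs_triang_inv (f (x + h, y + k, t + s)) (f (x, y, t))).
  simpl; lra.
Qed.

(** * Increments along one axis *)

(** Mean value theorem for [phi] minus its quadratic model, whose derivative is
    the error of the affine model of [psi]. *)
Lemma quadratic_increment phi psi h a b M :
  (forall z, Rmin 0 h < z < Rmax 0 h -> is_derive phi z (psi z)) ->
  (forall z, Rmin 0 h <= z <= Rmax 0 h -> continuity_pt phi z) ->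
  (forall z, Rmin 0 h <= z <= Rmax 0 h -> Rabs (psi z - (a + b * z)) <= M) ->
  Rabs (phi h - phi 0 - (a * h + b * h ^ 2 / 2)) <= M * Rabs h.
Proof.
intros Hd Hc Hb.
destruct (MVT_gen (fun z => phi z - (a * z + b * z ^ 2 / 2)) 0 h
  (fun z => psi z - (a + b * z))) as (z & Hz & E).
- intros z Hz; apply (is_derive_minus phi); [now apply Hd|].
  auto_derive; [trivial|]; field.
- intros z Hz; apply continuity_pt_minus; [now apply Hc|].
  apply derivable_continuous_pt, ex_derive_Reals_0; auto_derive; trivial.
- replace (phi h - phi 0 - (a * h + b * h ^ 2 / 2))
    with (phi h - (a * h + b * h ^ 2 / 2) - (phi 0 - (a * 0 + b * 0 ^ 2 / 2)))
    by field.
  rewrite E, Rminus_0_r, Rabs_mult.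
  apply Rmult_le_compat_r; [apply Rabs_pos | now apply Hb].
Qed.

Lemma between_0_Rabs h z : Rmin 0 h <= z <= Rmax 0 h -> Rabs z <= Rabs h.
Proof.
unfold Rmin, Rmax, Rabs.
destruct (Rle_dec 0 h), (Rcase_abs z), (Rcase_abs h); lra.
Qed.

Lemma is_derive_shift (f : R -> R) x l z :
  is_derive f (x + z) l -> is_derive (fun w => f (x + w)) z l.
Proof.
intros H; rewrite <- (Rmult_1_l l).
apply (is_derive_comp f (fun w => x + w)); trivial.
auto_derive; trivial.
Qed.

Lemma is_derive_continuity_pt (f : R -> R) x l : is_derive f x l -> continuity_pt f x.
Proof.
intros H; apply continuity_pt_filterlim.
apply (ex_derive_continuous f x); now exists l.
Qed.

Lemma increment_bound n K r h k s d :
  0 <= K -> d <= size h k s ->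
  r <= K * size h k s ^ n * d -> r <= K * size h k s ^ S n.
Proof.
intros HK Hd H; eapply Rle_trans; [exact H|].
simpl; rewrite (Rmult_comm (size h k s)), <- Rmult_assoc.
apply Rmult_le_compat_l; trivial.
apply Rmult_le_pos; trivial; apply pow_le, size_ge0.
Qed.

(** The other two coordinates are frozen in the affine model of [fx], and every
    point of the path has a displacement no larger than the final one. *)
Lemma increment_x n (f fx : R * R * R -> R) x y t A B C D :
  0 <= t ->
  (forall X, spacetime X -> is_partial_x f X (fx X)) ->
  small_O n (fun h k s => fx (x + h, y + k, t + s) - (A + B * h + C * k + D * s)) ->
  small_O (S n) (fun h k s => f (x + h, y + k, t + s) - f (x, y + k, t + s)
     - (A * h + B * h ^ 2 / 2 + C * h * k + D * h * s)).
Proof.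
intros Ht Hf (K & e & HK & He & H); exists K, e; repeat split; trivial.
intros h k s Hs Hd.
assert (HD : forall z, is_derive (fun w => f (x + w, y + k, t + s)) z
               (fx (x + z, y + k, t + s))).
{ intros z; apply (is_derive_shift (fun w => f (w, y + k, t + s))).
  apply (Hf (x + z, y + k, t + s)); unfold spacetime; simpl; lra. }
apply (increment_bound n K _ h k s (Rabs h)); trivial.
{ unfold size; pose proof (Rabs_pos k); pose proof (Rabs_pos s); lra. }
replace (f (x, y + k, t + s)) with (f (x + 0, y + k, t + s))
  by (now rewrite Rplus_0_r).
replace (A * h + B * h ^ 2 / 2 + C * h * k + D * h * s)
  with ((A + C * k + D * s) * h + B * h ^ 2 / 2) by field.
apply (quadratic_increment (fun w => f (x + w, y + k, t + s))
         (fun w => fx (x + w, y + k, t + s))).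
- intros z _; apply HD.
- intros z _; eapply is_derive_continuity_pt, HD.
- intros z Hz; apply between_0_Rabs in Hz.
  assert (Hsz : size z k s <= size h k s) by (unfold size; lra).
  replace (A + C * k + D * s + B * z) with (A + B * z + C * k + D * s) by ring.
  eapply Rle_trans; [apply H; trivial; lra|].
  apply Rmult_le_compat_l; trivial; apply pow_incr; split; trivial.
  apply size_ge0.
Qed.

Definition swap_xy (f : R * R * R -> R) (X : R * R * R) : R :=
  let '(x, y, t) := X in f (y, x, t).

Lemma increment_y n (f fy : R * R * R -> R) x y t A B C D :
  0 <= t ->
  (forall X, spacetime X -> is_partial_y f X (fy X)) ->
  small_O n (fun h k s => fy (x + h, y + k, t + s) - (A + B * h + C * k + D * s)) ->
  small_O (S n) (fun h k s => f (x + h, y + k, t + s) - f (x + h, y, t + s)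
     - (A * k + B * h * k + C * k ^ 2 / 2 + D * k * s)).
Proof.
intros Ht Hf H.
apply (small_O_subst n _ (fun _ k _ => k) (fun h _ _ => h) (fun _ _ s => s)) in H;
  [|trivial|intros; apply size_swap_xy].
apply (small_O_ext n _ (fun h k s => swap_xy fy (y + h, x + k, t + s)
  - (A + C * h + B * k + D * s))) in H; [|intros; simpl; ring].
apply (increment_x n (swap_xy f)) in H; trivial.
- apply (small_O_subst _ _ (fun _ k _ => k) (fun h _ _ => h) (fun _ _ s => s)) in H;
    [|trivial|intros; apply size_swap_xy].
  revert H; apply small_O_ext; intros; simpl; field.
- intros [[x0 y0] t0] H0; apply (Hf (y0, x0, t0) H0).
Qed.

(** Only the time-zero boundary distinguishes the one-sided time derivative from
    the usual one. *)
Lemma is_partial_t_interior f x y t l :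
  0 < t -> is_partial_t f (x, y, t) l -> is_derive (fun s => f (x, y, s)) t l.
Proof.
intros Ht [Hl Hd]; split; [apply is_linear_scal_l|].
intros z Hz eps.
assert (Hz' : is_filter_lim (within (fun s => 0 <= s) (locally t)) z).
{ intros P HP; apply filter_le_within, Hz, HP. }
generalize (Hd z Hz' eps); unfold within; intros Hw.
assert (Hpos : locally t (fun s : R => 0 <= s)).
{ apply (filter_imp (fun s => 0 < s)); [intros; lra|].
  now apply (open_gt 0 t). }
generalize (filter_and _ _ Hpos Hw); apply filter_imp; intros s [H0 H1]; auto.
Qed.

Lemma continuous_triple (a b c : R -> R) w :
  continuous a w -> continuous b w -> continuous c w ->
  continuous (fun w => (a w, b w, c w)) w.
Proof.
intros Ha Hb Hc P [d HP].
assert (Hball : forall q : R -> R, continuous q w ->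
  locally w (fun w' => ball (q w) d (q w'))).
{ intros q Hq; apply (Hq _ (locally_ball _ d)). }
generalize (filter_and _ _ (Hball a Ha) (filter_and _ _ (Hball b Hb) (Hball c Hc))).
unfold filtermap; apply filter_imp; intros w' (Wa & Wb & Wc).
apply HP; repeat split; trivial.
Qed.

(** A path that stays in [spacetime] turns relative continuity into ordinary
    continuity. *)
Lemma continuous_on_comp (f : R * R * R -> R) (q : R -> R * R * R) :
  continuous_on spacetime f -> (forall s, spacetime (q s)) ->
  (forall s, continuous q s) -> forall s, continuous (fun s => f (q s)) s.
Proof.
intros Hf Hsp Hq s P HP.
generalize (Hq s _ (Hf (q s) (Hsp s) P HP)); unfold filtermap, within.
apply filter_imp; intros w Hw; apply Hw, Hsp.
Qed.

Lemma increment_t n (f ft : R * R * R -> R) x y t A B C D :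
  0 <= t -> continuous_on spacetime f ->
  (forall X, spacetime X -> is_partial_t f X (ft X)) ->
  small_O n (fun h k s => ft (x + h, y + k, t + s) - (A + B * h + C * k + D * s)) ->
  small_O (S n) (fun h k s => f (x + h, y + k, t + s) - f (x + h, y + k, t)
     - (A * s + B * h * s + C * k * s + D * s ^ 2 / 2)).
Proof.
intros Ht Hc Hf (K & e & HK & He & H); exists K, e; repeat split; trivial.
intros h k s Hs Hd.
apply (increment_bound n K _ h k s (Rabs s)); trivial.
{ unfold size; pose proof (Rabs_pos h); pose proof (Rabs_pos k); lra. }
(* Clamping the time at 0 makes the path continuous on both sides of its starting
   point, as the mean value theorem wants, even when the base time is 0. *)
set (phi := fun w => f (x + h, y + k, Rmax 0 (t + w))).
replace (f (x + h, y + k, t + s)) with (phi s)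
  by (unfold phi; now rewrite Rmax_right by lra).
replace (f (x + h, y + k, t)) with (phi 0)
  by (unfold phi; now rewrite Rplus_0_r, Rmax_right by lra).
replace (A * s + B * h * s + C * k * s + D * s ^ 2 / 2)
  with ((A + B * h + C * k) * s + D * s ^ 2 / 2) by field.
apply (quadratic_increment phi (fun w => ft (x + h, y + k, t + w)));
  rewrite Rmin_left, Rmax_right by lra.
- intros z Hz.
  apply is_derive_ext_loc with (fun w => f (x + h, y + k, t + w)).
  + apply (filter_imp (fun w => 0 < w)).
    * intros w Hw; unfold phi; now rewrite Rmax_right by lra.
    * now apply (open_gt 0 z).
  + apply (is_derive_shift (fun w => f (x + h, y + k, w))).
    apply is_partial_t_interior; [lra|].
    apply Hf; unfold spacetime; simpl; lra.
- intros z _; apply continuity_pt_filterlim.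
  apply (continuous_on_comp f (fun w => (x + h, y + k, Rmax 0 (t + w)))); trivial.
  + intros w; apply Rmax_l.
  + intros w; apply continuous_triple; [apply continuous_const ..|].
    apply (continuous_ext (fun w => (t + w + Rabs (t + w)) / 2)).
    * intros w'; unfold Rmax, Rabs.
      destruct (Rle_dec 0 (t + w')), (Rcase_abs (t + w')); simpl; lra.
    * apply continuity_pt_filterlim; reg.
- intros z Hz.
  assert (Hz' : Rabs z <= Rabs s) by (rewrite !Rabs_pos_eq by lra; lra).
  assert (Hsz : size h k z <= size h k s) by (unfold size; lra).
  eapply Rle_trans; [apply H; lra|].
  apply Rmult_le_compat_l; trivial; apply pow_incr; split; trivial.
  apply size_ge0.
Qed.

(** * First-order expansions and exchange of derivatives *)

Definition gradient (f fx fy ft : R * R * R -> R) : Prop :=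
  forall X, spacetime X ->
    is_partial_x f X (fx X) /\ is_partial_y f X (fy X) /\ is_partial_t f X (ft X).

(** The coefficients are determined by [f]: they are its partial derivatives.
    Using them in place of chosen second derivatives of p, u and v lets linear
    combinations be formed freely. *)
Definition expansion (f : R * R * R -> R) (x y t A B C : R) : Prop :=
  small_O 2 (fun h k s =>
    f (x + h, y + k, t + s) - (f (x, y, t) + A * h + B * k + C * s)).

(** The displacement is travelled one axis at a time: x, then y, then t. *)
Lemma gradient_expansion n f fx fy ft x y t A B C :
  0 <= t -> continuous_on spacetime f -> gradient f fx fy ft ->
  small_O n (fun h k s => fx (x + h, y + k, t + s) - A) ->
  small_O n (fun h k s => fy (x + h, y + k, t + s) - B) ->
  small_O n (fun h k s => ft (x + h, y + k, t + s) - C) ->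
  small_O (S n) (fun h k s =>
    f (x + h, y + k, t + s) - (f (x, y, t) + A * h + B * k + C * s)).
Proof.
intros Ht Hc Hg Hx Hy Hz.
assert (Ix : small_O (S n) (fun h k s => f (x + h, y + k, t + s)
  - f (x, y + k, t + s) - (A * h + 0 * h ^ 2 / 2 + 0 * h * k + 0 * h * s))).
{ apply (increment_x n f fx); [trivial|intros X HX; apply (Hg X HX)|].
  revert Hx; apply small_O_ext; intros; ring. }
assert (Iy : small_O (S n) (fun h k s => f (x + h, y + k, t + s)
  - f (x + h, y, t + s) - (B * k + 0 * h * k + 0 * k ^ 2 / 2 + 0 * k * s))).
{ apply (increment_y n f fy); [trivial|intros X HX; apply (Hg X HX)|].
  revert Hy; apply small_O_ext; intros; ring. }
assert (It : small_O (S n) (fun h k s => f (x + h, y + k, t + s)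
  - f (x + h, y + k, t) - (C * s + 0 * h * s + 0 * k * s + 0 * s ^ 2 / 2))).
{ apply (increment_t n f ft); [trivial|trivial|intros X HX; apply (Hg X HX)|].
  revert Hz; apply small_O_ext; intros; ring. }
apply (small_O_subst _ _ (fun _ _ _ => 0) (fun _ k _ => k) (fun _ _ s => s)) in Iy;
  [|trivial|intros; apply size_drop_h].
apply (small_O_subst _ _ (fun _ _ _ => 0) (fun _ _ _ => 0) (fun _ _ s => s)) in It;
  [|trivial|intros; apply size_drop_hk].
generalize (small_O_plus _ _ _ Ix (small_O_plus _ _ _ Iy It)).
apply small_O_ext; intros; rewrite !Rplus_0_r; field.
Qed.

Lemma class_C_continuous_on k f : class_C k f -> continuous_on spacetime f.
Proof. destruct k; intros H; apply H. Qed.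

(** A Lipschitz bound: with the zero gradient as model, boundedness of the
    derivatives near the base point is enough for [gradient_expansion]. *)
Lemma class_C1_small_O_1 f x y t : 0 <= t -> class_C 1 f ->
  small_O 1 (fun h k s => f (x + h, y + k, t + s) - f (x, y, t)).
Proof.
intros Ht [Hc (fx & fy & ft & Hg & Hx & Hy & Hz)].
apply (small_O_ext _ (fun h k s =>
  f (x + h, y + k, t + s) - (f (x, y, t) + 0 * h + 0 * k + 0 * s))).
{ intros; ring. }
apply (gradient_expansion 0 f fx fy ft); trivial;
  [generalize (continuous_small_O_0 fx x y t Ht (class_C_continuous_on 0 _ Hx))
  |generalize (continuous_small_O_0 fy x y t Ht (class_C_continuous_on 0 _ Hy))
  |generalize (continuous_small_O_0 ft x y t Ht (class_C_continuous_on 0 _ Hz))];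
  apply small_O_ext; intros; ring.
Qed.

Lemma class_C2_expansion f x y t : 0 <= t -> class_C 2 f ->
  exists A B C, expansion f x y t A B C.
Proof.
intros Ht [Hc (fx & fy & ft & Hg & Hx & Hy & Hz)].
exists (fx (x, y, t)), (fy (x, y, t)), (ft (x, y, t)).
apply (gradient_expansion 1 f fx fy ft); trivial; now apply class_C1_small_O_1.
Qed.

Lemma expansion_lin a b f g x y t A B C A' B' C' :
  expansion f x y t A B C -> expansion g x y t A' B' C' ->
  expansion (fun X => a * f X + b * g X) x y t
    (a * A + b * A') (a * B + b * B') (a * C + b * C').
Proof.
intros Hf Hg; generalize (small_O_lin _ a b _ _ Hf Hg).
apply small_O_ext; intros; ring.
Qed.

Lemma expansion_scal a f x y t A B C :
  expansion f x y t A B C ->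
  expansion (fun X => a * f X) x y t (a * A) (a * B) (a * C).
Proof.
intros Hf; generalize (small_O_lin _ a 0 _ _ Hf Hf).
apply small_O_ext; intros; ring.
Qed.

Lemma expansion_swap_xy f x y t A B C :
  expansion f x y t A B C -> expansion (swap_xy f) y x t B A C.
Proof.
intros H.
apply (small_O_subst _ _ (fun _ k _ => k) (fun h _ _ => h) (fun _ _ s => s)) in H;
  [|trivial|intros; apply size_swap_xy].
revert H; apply small_O_ext; intros; simpl; ring.
Qed.

(** On the diagonal h = s = r a nonzero quadratic term would dominate the cubic
    bound. *)
Lemma small_O_3_bilinear_eq0 a : small_O 3 (fun h _ s => a * (h * s)) -> a = 0.
Proof.
intros (K & e & HK & He & H).
destruct (Req_dec a 0) as [|Ha]; [trivial|exfalso].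
assert (HaP := Rabs_pos_lt a Ha).
(* The bound at displacement (r, 0, r), of size 2 r, is 8 K r^3; the choice
   makes 8 K r smaller than |a|. *)
set (r := Rmin (e / 4) (Rabs a / (8 * K + 1) / 2)).
assert (Hr : 0 < r).
{ apply Rmin_glb_lt; [lra|].
  apply Rdiv_lt_0_compat; [apply Rdiv_lt_0_compat|]; lra. }
assert (Hre : r <= e / 4) by apply Rmin_l.
assert (Hra : r * (8 * K + 1) < Rabs a).
{ assert (r <= Rabs a / (8 * K + 1) / 2) by apply Rmin_r.
  apply Rle_lt_trans with (Rabs a / (8 * K + 1) / 2 * (8 * K + 1)).
  - apply Rmult_le_compat_r; lra.
  - replace (Rabs a / (8 * K + 1) / 2 * (8 * K + 1)) with (Rabs a / 2)
      by (field; lra); lra. }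
assert (Hsz : size r 0 r = 2 * r).
{ unfold size; rewrite Rabs_R0, !Rabs_pos_eq by lra; ring. }
assert (B := H r 0 r ltac:(lra) ltac:(lra)); rewrite Hsz in B.
rewrite Rabs_mult, (Rabs_pos_eq (r * r)) in B by nra.
assert (0 < r * r) by nra; nra.
Qed.

(** The rectangular difference of f in the (x, t) plane is C h s when computed
    from x-increments and A' h s when computed from t-increments, up to third
    order in both cases. *)
Lemma clairaut_xt f fx ft x y t A B C A' B' C' :
  0 <= t -> continuous_on spacetime f ->
  (forall X, spacetime X -> is_partial_x f X (fx X)) ->
  (forall X, spacetime X -> is_partial_t f X (ft X)) ->
  expansion fx x y t A B C -> expansion ft x y t A' B' C' -> C = A'.
Proof.
intros Ht Hc Hx Hz Ex Et.
apply (increment_x 2 f fx) in Ex; trivial.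
apply (increment_t 2 f ft) in Et; trivial.
assert (Ex0 := small_O_subst _ _ (fun h _ _ => h) (fun _ k _ => k) (fun _ _ _ => 0)
  ltac:(intros; lra) size_drop_s Ex).
assert (Et0 := small_O_subst _ _ (fun _ _ _ => 0) (fun _ k _ => k) (fun _ _ s => s)
  ltac:(trivial) size_drop_h Et).
enough (C - A' = 0) by lra; apply small_O_3_bilinear_eq0.
generalize (small_O_lin _ 1 (-1) _ _
  (small_O_lin _ 1 (-1) _ _ Et Et0) (small_O_lin _ 1 (-1) _ _ Ex Ex0)).
apply small_O_ext; intros; simpl; rewrite !Rplus_0_r; field.
Qed.

Lemma clairaut_yt f fy ft x y t A B C A' B' C' :
  0 <= t -> continuous_on spacetime f ->
  (forall X, spacetime X -> is_partial_y f X (fy X)) ->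
  (forall X, spacetime X -> is_partial_t f X (ft X)) ->
  expansion fy x y t A B C -> expansion ft x y t A' B' C' -> C = B'.
Proof.
intros Ht Hc Hy Hz Ey Et.
apply (clairaut_xt (swap_xy f) (swap_xy fy) (swap_xy ft) y x t B A C B' A' C');
  try (now apply expansion_swap_xy); trivial.
- intros [[a b] s] HX P HP.
  generalize (Hc (b, a, s) HX P HP); intros [d Hd]; exists d.
  intros [[a' b'] s'] [[Ha Hb] Hs] HX'; apply (Hd (b', a', s')); trivial.
  repeat split; trivial.
- intros [[a b] s] HX; apply (Hy (b, a, s) HX).
- intros [[a b] s] HX; apply (Hz (b, a, s) HX).
Qed.

(** * Expansions in one small parameter *)

Definition O_cubed (g : R -> R) : Prop :=
  exists K e : R, 0 < e /\ forall r, 0 <= r < e -> Rabs (g r) <= K * r ^ 3.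

Lemma O_cubed_ext g1 g2 :
  (forall r, 0 <= r -> g1 r = g2 r) -> O_cubed g1 -> O_cubed g2.
Proof.
intros E (K & e & He & H); exists K, e; split; trivial.
intros r Hr; rewrite <- E by apply Hr; auto.
Qed.

Lemma O_cubed_lin a b g1 g2 :
  O_cubed g1 -> O_cubed g2 -> O_cubed (fun r => a * g1 r + b * g2 r).
Proof.
intros (K1 & e1 & He1 & H1) (K2 & e2 & He2 & H2).
exists (Rabs a * K1 + Rabs b * K2), (Rmin e1 e2); split.
- now apply Rmin_glb_lt.
- intros r Hr.
  pose proof (Rmin_l e1 e2); pose proof (Rmin_r e1 e2).
  assert (D1 := H1 r ltac:(lra)); assert (D2 := H2 r ltac:(lra)).
  eapply Rle_trans; [apply Rabs_triang|]; rewrite !Rabs_mult.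
  pose proof (Rmult_le_compat_l _ _ _ (Rabs_pos a) D1).
  pose proof (Rmult_le_compat_l _ _ _ (Rabs_pos b) D2); lra.
Qed.

Lemma O_cubed_scale a g : 0 <= a -> O_cubed g -> O_cubed (fun r => g (a * r)).
Proof.
intros Ha (K & e & He & H); exists (K * a ^ 3), (e / (a + 1)); split.
- apply Rdiv_lt_0_compat; lra.
- intros r Hr; eapply Rle_trans; [apply H|right; ring].
  split; [nra|].
  assert (r * (a + 1) < e); [|nra].
  replace e with (e / (a + 1) * (a + 1)) by (field; lra).
  apply Rmult_lt_compat_r; lra.
Qed.

Lemma time_expansion f ft x y t A B C :
  0 <= t -> continuous_on spacetime f ->
  (forall X, spacetime X -> is_partial_t f X (ft X)) ->
  expansion ft x y t A B C ->
  O_cubed (fun s => f (x, y, t + s) - (f (x, y, t) + ft (x, y, t) * s + C * s ^ 2 / 2)).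
Proof.
intros Ht Hc Hz Et; apply (increment_t 2 f ft) in Et; trivial.
destruct Et as (K & e & HK & He & H); exists K, e; split; trivial.
intros s Hs; specialize (H 0 0 s).
assert (Hsz : size 0 0 s = s) by (unfold size; rewrite Rabs_R0, Rabs_pos_eq; lra).
rewrite Hsz in H; eapply Rle_trans; [right|apply H; lra].
f_equal; rewrite !Rplus_0_r; field.
Qed.

(** * Circle integrals *)

(** A second-order Taylor polynomial restricted to a circle. *)
Definition trig2 (a b1 b2 q1 q2 q3 theta : R) : R :=
  a + b1 * cos theta + b2 * sin theta + q1 * cos theta ^ 2
  + q2 * (cos theta * sin theta) + q3 * sin theta ^ 2.

(** The increments in x at (h, k) and in y at (0, k) are added, with
    h = r cos theta and k = r sin theta; the size |h| + |k| is at most 2 r. *)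
Lemma circle_expansion f fx fy x y t A B C A' B' C' :
  0 <= t ->
  (forall X, spacetime X -> is_partial_x f X (fx X)) ->
  (forall X, spacetime X -> is_partial_y f X (fy X)) ->
  expansion fx x y t A B C -> expansion fy x y t A' B' C' ->
  exists K e, 0 < e /\ forall r theta, 0 <= r < e ->
    Rabs (f (circle_pt x y t r theta)
      - trig2 (f (x, y, t)) (r * fx (x, y, t)) (r * fy (x, y, t))
          (r ^ 2 / 2 * A) (r ^ 2 * B) (r ^ 2 / 2 * B') theta) <= K * r ^ 3.
Proof.
intros Ht Hx Hy Ex Ey.
apply (increment_x 2 f fx) in Ex; trivial; apply (increment_y 2 f fy) in Ey; trivial.
apply (small_O_subst _ _ (fun _ _ _ => 0) (fun _ k _ => k) (fun _ _ s => s)) in Ey;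
  [|trivial|intros; apply size_drop_h].
destruct (small_O_plus _ _ _ Ex Ey) as (K & e & HK & He & H); clear Ex Ey.
exists (K * 2 ^ 3), (e / 2); split; [lra|]; intros r theta Hr.
specialize (H (r * cos theta) (r * sin theta) 0 (Rle_refl 0)).
assert (Hsz : size (r * cos theta) (r * sin theta) 0 <= 2 * r).
{ unfold size; rewrite Rabs_R0, !Rabs_mult, (Rabs_pos_eq r) by lra.
  assert (Rabs (cos theta) <= 1) by apply Rabs_le, COS_bound.
  assert (Rabs (sin theta) <= 1) by apply Rabs_le, SIN_bound.
  nra. }
eapply Rle_trans; [right|eapply Rle_trans; [apply H; lra|]].
- f_equal; unfold circle_pt, trig2; rewrite !Rplus_0_r; field.
- rewrite Rmult_assoc, <- Rpow_mult_distr.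
  apply Rmult_le_compat_l; trivial; apply pow_incr; split; trivial.
  apply size_ge0.
Qed.

Lemma continuous_circle (f : R * R * R -> R) x y t r theta :
  0 <= t -> continuous_on spacetime f ->
  continuous (fun th => f (circle_pt x y t r th)) theta.
Proof.
intros Ht Hf; revert theta.
apply (continuous_on_comp f (circle_pt x y t r)); trivial; intros th.
apply continuous_triple; [| |apply continuous_const].
all: apply (ex_derive_continuous (V := R_NormedModule)); auto_derive; trivial.
Qed.

Lemma is_RInt_antiderivative (F G : R -> R) a b l :
  (forall z, is_derive F z (G z)) -> (forall z, ex_derive G z) ->
  F b - F a = l -> is_RInt G a b l.
Proof.
intros HF HG <-; apply (is_RInt_derive F G); intros z _; [apply HF|].
apply (ex_derive_continuous (V := R_NormedModule)), HG.
Qed.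

Lemma sin_sqr z : sin z * sin z = 1 - cos z * cos z.
Proof. pose proof (sin2_cos2 z) as H; unfold Rsqr in H; lra. Qed.

(* An antiderivative of cos^2 or sin^2 differentiates back to it only modulo
   sin^2 + cos^2 = 1, which [field] is given as a rewriting rule. *)
Ltac integrate_trig2 F :=
  apply (is_RInt_antiderivative F);
  [ intros z; auto_derive; [trivial|unfold trig2; field [(sin_sqr z)]]
   | intros z; unfold trig2; auto_derive; trivial
   | rewrite sin_2PI, cos_2PI, sin_0, cos_0; field ].

Lemma is_RInt_trig2 a b1 b2 q1 q2 q3 :
  is_RInt (trig2 a b1 b2 q1 q2 q3) 0 (2 * PI) (2 * PI * (a + (q1 + q3) / 2)).
Proof.
integrate_trig2
  (fun z => a * z + b1 * sin z - b2 * cos z + q1 * (z / 2 + sin z * cos z / 2)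
     + q2 * sin z ^ 2 / 2 + q3 * (z / 2 - sin z * cos z / 2)).
Qed.

Lemma is_RInt_trig2_cos a b1 b2 q1 q2 q3 :
  is_RInt (fun z => trig2 a b1 b2 q1 q2 q3 z * cos z) 0 (2 * PI) (PI * b1).
Proof.
integrate_trig2
  (fun z => a * sin z + b1 * (z / 2 + sin z * cos z / 2) + b2 * sin z ^ 2 / 2
     + q1 * (sin z - sin z ^ 3 / 3) - q2 * cos z ^ 3 / 3 + q3 * sin z ^ 3 / 3).
Qed.

Lemma is_RInt_trig2_sin a b1 b2 q1 q2 q3 :
  is_RInt (fun z => trig2 a b1 b2 q1 q2 q3 z * sin z) 0 (2 * PI) (PI * b2).
Proof.
integrate_trig2
  (fun z => - a * cos z + b1 * sin z ^ 2 / 2 + b2 * (z / 2 - sin z * cos z / 2)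
     - q1 * cos z ^ 3 / 3 + q2 * sin z ^ 3 / 3 + q3 * (- cos z + cos z ^ 3 / 3)).
Qed.

Lemma ex_RInt_circle (f : R * R * R -> R) (w : R -> R) x y t r :
  0 <= t -> continuous_on spacetime f -> (forall theta, continuous w theta) ->
  ex_RInt (fun theta => f (circle_pt x y t r theta) * w theta) 0 (2 * PI).
Proof.
intros Ht Hf Hw; apply (ex_RInt_continuous (V := R_CompleteNormedModule)).
intros theta _.
apply (continuous_mult (fun th => f (circle_pt x y t r th)) w); trivial.
now apply continuous_circle.
Qed.

Lemma RInt_circle_combination (p u v : R * R * R -> R) x y t r :
  0 <= t -> continuous_on spacetime p -> continuous_on spacetime u ->
  continuous_on spacetime v ->
  RInt (fun theta => p (circle_pt x y t r theta)
    - u (circle_pt x y t r theta) * cos theta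
    - v (circle_pt x y t r theta) * sin theta) 0 (2 * PI)
  = RInt (fun theta => p (circle_pt x y t r theta)) 0 (2 * PI)
    - RInt (fun theta => u (circle_pt x y t r theta) * cos theta) 0 (2 * PI)
    - RInt (fun theta => v (circle_pt x y t r theta) * sin theta) 0 (2 * PI).
Proof.
intros Ht Hp Hu Hv.
assert (Ep : ex_RInt (fun theta => p (circle_pt x y t r theta)) 0 (2 * PI)).
{ apply (ex_RInt_continuous (V := R_CompleteNormedModule)); intros theta _.
  now apply continuous_circle. }
assert (Eu := ex_RInt_circle u cos x y t r Ht Hu continuous_cos).
assert (Ev := ex_RInt_circle v sin x y t r Ht Hv continuous_sin).
apply is_RInt_unique.
apply (is_RInt_minus (V := R_NormedModule));
  [apply (is_RInt_minus (V := R_NormedModule))|];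
  now apply (RInt_correct (V := R_CompleteNormedModule)).
Qed.

(** The uniform error of [circle_expansion] survives integration against a weight
    bounded by 1, so that only the integral of the Taylor polynomial matters. *)
Lemma circle_moment f fx fy x y t A B C A' B' C' (w : R -> R) (I : R -> R) :
  0 <= t -> continuous_on spacetime f ->
  (forall X, spacetime X -> is_partial_x f X (fx X)) ->
  (forall X, spacetime X -> is_partial_y f X (fy X)) ->
  expansion fx x y t A B C -> expansion fy x y t A' B' C' ->
  (forall theta, continuous w theta) -> (forall theta, Rabs (w theta) <= 1) ->
  (forall r, is_RInt (fun theta => trig2 (f (x, y, t)) (r * fx (x, y, t))
     (r * fy (x, y, t)) (r ^ 2 / 2 * A) (r ^ 2 * B) (r ^ 2 / 2 * B') theta * w theta)
     0 (2 * PI) (I r)) ->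
  O_cubed (fun r =>
    RInt (fun theta => f (circle_pt x y t r theta) * w theta) 0 (2 * PI) - I r).
Proof.
intros Ht Hc Hx Hy Ex Ey Hwc Hw HI.
destruct (circle_expansion f fx fy x y t _ _ _ _ _ _ Ht Hx Hy Ex Ey)
  as (K & e & He & H).
exists (2 * PI * K), e; split; trivial; intros r Hr.
assert (PIpos := PI_RGT_0).
assert (Ef := ex_RInt_circle f w x y t r Ht Hc Hwc).
assert (Ed : is_RInt (fun theta => f (circle_pt x y t r theta) * w theta
    - trig2 (f (x, y, t)) (r * fx (x, y, t)) (r * fy (x, y, t))
        (r ^ 2 / 2 * A) (r ^ 2 * B) (r ^ 2 / 2 * B') theta * w theta) 0 (2 * PI)
  (RInt (fun theta => f (circle_pt x y t r theta) * w theta) 0 (2 * PI) - I r)).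
{ apply (is_RInt_minus (V := R_NormedModule)); [|apply HI].
  now apply (RInt_correct (V := R_CompleteNormedModule)). }
rewrite <- (is_RInt_unique _ _ _ _ Ed).
replace (2 * PI * K * r ^ 3) with ((2 * PI - 0) * (K * r ^ 3)) by ring.
apply abs_RInt_le_const; [lra|eexists; exact Ed|].
intros theta _; rewrite <- Rmult_minus_distr_r, Rabs_mult.
specialize (H r theta Hr); specialize (Hw theta).
rewrite <- (Rmult_1_r (K * r ^ 3)); apply Rmult_le_compat; trivial; apply Rabs_pos.
Qed.

Lemma circle_integral f fx fy x y t A B C A' B' C' :
  0 <= t -> continuous_on spacetime f ->
  (forall X, spacetime X -> is_partial_x f X (fx X)) ->
  (forall X, spacetime X -> is_partial_y f X (fy X)) ->
  expansion fx x y t A B C -> expansion fy x y t A' B' C' ->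
  O_cubed (fun r => RInt (fun theta => f (circle_pt x y t r theta)) 0 (2 * PI)
     - 2 * PI * (f (x, y, t) + r ^ 2 / 4 * (A + B'))).
Proof.
intros Ht Hc Hx Hy Ex Ey.
eapply O_cubed_ext; [|apply (circle_moment f fx fy x y t _ _ _ _ _ _ (fun _ => 1)
  (fun r => 2 * PI * (f (x, y, t) + (r ^ 2 / 2 * A + r ^ 2 / 2 * B') / 2))
  Ht Hc Hx Hy Ex Ey)].
- intros r _; cbv beta; f_equal; [|field].
  apply RInt_ext; intros; apply Rmult_1_r.
- intros theta; apply continuous_const.
- intros theta; rewrite Rabs_R1; lra.
- intros r; eapply is_RInt_ext, is_RInt_trig2; intros; simpl; symmetry; apply Rmult_1_r.
Qed.

Lemma circle_moment_cos f fx fy x y t A B C A' B' C' :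
  0 <= t -> continuous_on spacetime f ->
  (forall X, spacetime X -> is_partial_x f X (fx X)) ->
  (forall X, spacetime X -> is_partial_y f X (fy X)) ->
  expansion fx x y t A B C -> expansion fy x y t A' B' C' ->
  O_cubed (fun r =>
    RInt (fun theta => f (circle_pt x y t r theta) * cos theta) 0 (2 * PI)
    - PI * (r * fx (x, y, t))).
Proof.
intros Ht Hc Hx Hy Ex Ey.
apply (circle_moment f fx fy x y t A B C A' B' C'); trivial.
- apply continuous_cos.
- intros theta; apply Rabs_le, COS_bound.
- intros r; apply is_RInt_trig2_cos.
Qed.

Lemma circle_moment_sin f fx fy x y t A B C A' B' C' :
  0 <= t -> continuous_on spacetime f ->
  (forall X, spacetime X -> is_partial_x f X (fx X)) ->
  (forall X, spacetime X -> is_partial_y f X (fy X)) ->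
  expansion fx x y t A B C -> expansion fy x y t A' B' C' ->
  O_cubed (fun r =>
    RInt (fun theta => f (circle_pt x y t r theta) * sin theta) 0 (2 * PI)
    - PI * (r * fy (x, y, t))).
Proof.
intros Ht Hc Hx Hy Ex Ey.
apply (circle_moment f fx fy x y t A B C A' B' C'); trivial.
- apply continuous_sin.
- intros theta; apply Rabs_le, SIN_bound.
- intros r; apply is_RInt_trig2_sin.
Qed.

(** * Comparison of the two expansions *)

(** The equations speak of some derivatives at each point; uniqueness of the
    spatial ones identifies the time derivatives with combinations of given
    functions [px], [py], [ux], [vy], whose expansions are then available. *)
Lemma acoustic_partial_t c p u v px py ux vy :
  acoustic_solution c p u v ->
  (forall X, spacetime X -> is_partial_x p X (px X)) ->
  (forall X, spacetime X -> is_partial_y p X (py X)) ->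
  (forall X, spacetime X -> is_partial_x u X (ux X)) ->
  (forall X, spacetime X -> is_partial_y v X (vy X)) ->
  forall X, spacetime X ->
    is_partial_t p X (- c * ux X + - c * vy X) /\
    is_partial_t u X (- c * px X) /\
    is_partial_t v X (- c * py X).
Proof.
intros Hsol Hpx Hpy Hux Hvy X HX.
specialize (Hpx X HX); specialize (Hpy X HX).
specialize (Hux X HX); specialize (Hvy X HX).
destruct (Hsol X HX) as (pt & px' & py' & ut & ux' & vt & vy' &
  Ppt & Ppx & Ppy & Put & Pux & Pvt & Pvy & E1 & E2 & E3).
destruct X as [[x y] t].
assert (px' = px (x, y, t))
  by exact (eq_trans (eq_sym (is_derive_unique _ _ _ Ppx))
    (is_derive_unique _ _ _ Hpx)).
assert (py' = py (x, y, t))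
  by exact (eq_trans (eq_sym (is_derive_unique _ _ _ Ppy))
    (is_derive_unique _ _ _ Hpy)).
assert (ux' = ux (x, y, t))
  by exact (eq_trans (eq_sym (is_derive_unique _ _ _ Pux))
    (is_derive_unique _ _ _ Hux)).
assert (vy' = vy (x, y, t))
  by exact (eq_trans (eq_sym (is_derive_unique _ _ _ Pvy))
    (is_derive_unique _ _ _ Hvy)).
subst px' py' ux' vy'; split; [|split].
- now replace (- c * ux (x, y, t) + - c * vy (x, y, t)) with pt by lra.
- now replace (- c * px (x, y, t)) with ut by lra.
- now replace (- c * py (x, y, t)) with vt by lra.
Qed.

Theorem mainTheorem2 (c : R) (hc : 0 < c) (p u v : R * R * R -> R)
    (hp : class_C 3 p) (hu : class_C 3 u) (hv : class_C 3 v)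
    (hsol : acoustic_solution c p u v)
    (x y t : R) (ht : 0 <= t) (delta : R) (hdelta : 0 <= delta <= 1) :
  exists K eps : R, 0 < eps /\
    forall dt : R, 0 < dt < eps ->
      Rabs (p (x, y, t + dt) - EG2_pressure c delta p u v x y t dt)
        <= K * dt ^ 3.
Proof.
destruct hp as [cp (px & py & pt & Gp & Cpx & Cpy & _)].
destruct hu as [cu (ux & uy & ut & Gu & Cux & Cuy & _)].
destruct hv as [cv (vx & vy & vt & Gv & Cvx & Cvy & _)].
assert (Hpx := fun X HX => proj1 (Gp X HX)).
assert (Hpy := fun X HX => proj1 (proj2 (Gp X HX))).
assert (Hux := fun X HX => proj1 (Gu X HX)).
assert (Huy := fun X HX => proj1 (proj2 (Gu X HX))).
assert (Hvx := fun X HX => proj1 (Gv X HX)).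
assert (Hvy := fun X HX => proj1 (proj2 (Gv X HX))).
clear Gp Gu Gv.
assert (Htime := acoustic_partial_t c p u v px py ux vy hsol Hpx Hpy Hux Hvy).
destruct (class_C2_expansion px x y t ht Cpx) as (pxx & pxy & pxt & Epx).
destruct (class_C2_expansion py x y t ht Cpy) as (pyx & pyy & pyt & Epy).
destruct (class_C2_expansion ux x y t ht Cux) as (uxx & uxy & uxt & Eux).
destruct (class_C2_expansion uy x y t ht Cuy) as (uyx & uyy & uyt & Euy).
destruct (class_C2_expansion vx x y t ht Cvx) as (vxx & vxy & vxt & Evx).
destruct (class_C2_expansion vy x y t ht Cvy) as (vyx & vyy & vyt & Evy).
(* u_xt = (- c p_x)_x and v_yt = (- c p_y)_y *)
assert (Euxt : uxt = - c * pxx).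
{ refine (clairaut_xt u ux _ x y t _ _ _ _ _ _ ht cu Hux
    (fun X HX => proj1 (proj2 (Htime X HX))) Eux
    (expansion_scal _ _ _ _ _ _ _ _ Epx)). }
assert (Evyt : vyt = - c * pyy).
{ refine (clairaut_yt v vy _ x y t _ _ _ _ _ _ ht cv Hvy
    (fun X HX => proj2 (proj2 (Htime X HX))) Evy
    (expansion_scal _ _ _ _ _ _ _ _ Epy)). }
assert (Tp := time_expansion p _ x y t _ _ _ ht cp (fun X HX => proj1 (Htime X HX))
  (expansion_lin (- c) (- c) _ _ _ _ _ _ _ _ _ _ _ Eux Evy)).
assert (Ip := circle_integral p px py x y t _ _ _ _ _ _ ht cp Hpx Hpy Epx Epy).
assert (Iu := circle_moment_cos u ux uy x y t _ _ _ _ _ _ ht cu Hux Huy Eux Euy).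
assert (Iv := circle_moment_sin v vx vy x y t _ _ _ _ _ _ ht cv Hvx Hvy Evx Evy).
assert (Rp := O_cubed_scale c _ ltac:(lra) Ip).
assert (Ru := O_cubed_scale c _ ltac:(lra) Iu).
assert (Rv := O_cubed_scale c _ ltac:(lra) Iv).
assert (Rp1 := O_cubed_scale (delta / 2 * c) _ ltac:(nra) Ip).
assert (Rp2 := O_cubed_scale (delta * c) _ ltac:(nra) Ip).
clear Ip Iu Iv.
(* The coefficients with which the errors enter p(P) minus the operator: the
   one at time dt, those on the circle of radius c dt, and those on the two
   circles of radius delta c dt / 2 and delta c dt. *)
assert (Err := O_cubed_lin 1 1 _ _
  (O_cubed_lin 1 (- (1 / PI)) _ _ Tp
    (O_cubed_lin 1 (-1) _ _ Rp (O_cubed_lin 1 1 _ _ Ru Rv)))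
  (O_cubed_lin (1 / 3 * (4 / (2 * PI))) (- (1 / 3 * (1 / (2 * PI)))) _ _ Rp1 Rp2)).
clear Tp Rp Ru Rv Rp1 Rp2; cbv beta in Err.
assert (Hcub : O_cubed (fun dt => p (x, y, t + dt)
  - EG2_pressure c delta p u v x y t dt)).
{ revert Err; apply O_cubed_ext; intros dt _; unfold EG2_pressure.
  rewrite (RInt_circle_combination p u v) by trivial.
  rewrite Euxt, Evyt; field; apply PI_neq0. }
destruct Hcub as (K & e & He & H); exists K, e; split; trivial.
intros dt Hdt; apply H; lra.
Qed.
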